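(* Let $(M,g)$ be a connected, complete, stable minimal hypersurface in a Riemannian manifold $(\bar M,\bar g)$ such that the Ricci curvature $Ric_{\bar g}(\nu,\nu)$ of $(\bar M,\bar g)$ in the direction of the unit normal vector field $\nu$ to $(M,g)$ is non-negative at every point of $M$. If there exists a smooth function $u>0$ on $M$ with $u \in L^1(M,g)$ satisfying the inequality $L_g u \le 0$, and $(M,g)$ is parabolic, then $(M,g)$ must be a totally geodesic submanifold of $(\bar M,\bar g)$.
   Context: $(M,g)$ is isometrically immersed in $(\bar M,\bar g)$, $\dim \bar M = n+1 \ge 3$, $\dim M = n$, and $g$ is the induced metric. The Jacobi operator is $$L_g u := \Delta_g u + \left(\|A_g\|^2 + Ric_{\bar g}(\nu,\nu)\right)u,$$ where $\Delta_g u = \operatorname{div}(\operatorname{grad} u)$ is the Laplace–Beltrami operator and $A_g$ is the shape operator, $\|A_g\|^2 = g(A_g,A_g)$. The hypersurface is minimal if its mean curvature $\frac1n \operatorname{trace} A_g$ vanishes identically; a minimal hypersurface is stable if the second variation of its volume functional is non-negative for all compactly supported deformations. A function $u$ is superharmonic if $\Delta_g u \le 0$; a Riemannian manifold is parabolic if every positive superharmonic function on it is constant. *)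

(* Defs.v *)
From HB Require Import structures.
From mathcomp Require Import all_boot all_order all_algebra.
From mathcomp Require Import all_classical all_reals all_analysis.

Set Implicit Arguments.
Unset Strict Implicit.
Unset Printing Implicit Defensive.

Import Order.TTheory GRing.Theory Num.Theory numFieldNormedType.Exports.

Local Open Scope classical_set_scope.
Local Open Scope ring_scope.

Section Smoothness.
Context {R : realType} {V W : normedModType R}.

(* On a finite-dimensional [V] and an open [U] this is the usual notion of
   class C^k: directional derivatives in all directions, iterated [k] times,
   exist and are continuous on [U]. *)
Fixpoint Ck (k : nat) (U : set V) (f : V -> W) : Prop :=
  (forall x, U x -> {for x, continuous f}) /\
  if k is k'.+1 then
    forall v, (forall x, U x -> derivable f x v) /\ Ck k' U (fun x => 'D_v f x)
  else True.

Definition smooth_on (U : set V) (f : V -> W) : Prop := forall k, Ck k U f.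

End Smoothness.

(* A Hausdorff second countable smooth manifold without boundary, given by a
   (not necessarily maximal) smooth atlas.  Charts and their inverses are total
   functions, meaningful only on [chart_dom i] and [chart_img i].  [chart_at] selects a
   chart around each point; every notion evaluated with it below is
   independent of that selection. *)
Record manifold (R : realType) (n : nat) := Manifold {
  carrier :> topologicalType;
  manifold_hausdorff : hausdorff_space carrier;
  manifold_second_countable : @second_countable carrier;
  chart_index : Type;
  chart_dom : chart_index -> set carrier;
  chart_img : chart_index -> set 'rV[R]_n;
  chart : chart_index -> carrier -> 'rV[R]_n;
  param : chart_index -> 'rV[R]_n -> carrier;
  open_dom : forall i, open (chart_dom i);
  open_img : forall i, open (chart_img i);
  chart_in_img : forall i p, chart_dom i p -> chart_img i (chart i p);
  param_in_dom : forall i x, chart_img i x -> chart_dom i (param i x);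
  chartK : forall i p, chart_dom i p -> param i (chart i p) = p;
  paramK : forall i x, chart_img i x -> chart i (param i x) = x;
  chart_continuous : forall i p, chart_dom i p -> {for p, continuous (chart i)};
  param_continuous : forall i x, chart_img i x -> {for x, continuous (param i)};
  transition_smooth : forall i j,
    smooth_on (chart_img i `&` param i @^-1` chart_dom j) (chart j \o param i);
  chart_at : carrier -> chart_index;
  dom_chart_at : forall p, chart_dom (chart_at p) p
}.
Arguments chart_index {R n}.
Arguments chart_dom {R n m} i.
Arguments chart_img {R n m} i.
Arguments chart {R n m} i.
Arguments param {R n m} i.
Arguments chart_at {R n m} p.

Section SmoothMaps.
Context {R : realType}.

Definition smooth_into (V : normedModType R) (m : nat) (N : manifold R m)
    (U : set V) (h : V -> N) : Prop :=
  (forall x, U x -> {for x, continuous h}) /\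
  (forall a : chart_index N, smooth_on (U `&` h @^-1` chart_dom a) (chart a \o h)).

Definition smooth_map n m (M : manifold R n) (N : manifold R m) (f : M -> N) :=
  forall i : chart_index M, smooth_into (chart_img i) (f \o param i).

Definition smooth_fun n (M : manifold R n) (u : M -> R) :=
  forall i : chart_index M, smooth_on (chart_img i) (u \o param i : 'rV[R]_n -> R).

Definition local_map n m (M : manifold R n) (N : manifold R m) (f : M -> N)
    (i : chart_index M) (a : chart_index N) : 'rV[R]_n -> 'rV[R]_m :=
  chart a \o f \o param i.

End SmoothMaps.

(* Tangent vectors are row vectors of components, so that [v *m jacobian f x]
   is the image of [v] under the differential of [f] at [x]; the jacobian has
   entry d(f^j)/d(x^i) in row [i] and column [j]. *)
Section LocalGeometry.
Context {R : realType} {n : nat}.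
Implicit Types (g : 'rV[R]_n -> 'M[R]_n) (x : 'rV[R]_n).

Definition inner (G : 'M[R]_n) (v w : 'rV[R]_n) : R := (v *m G *m w^T) 0 0.

Definition partial (k : 'I_n) (f : 'rV[R]_n -> R) x : R :=
  'D_(delta_mx 0 k) f x.

(* Gamma^k_{ij} *)
Definition christoffel g (k i j : 'I_n) x : R :=
  2^-1 * \sum_l invmx (g x) k l *
    (partial i (fun y => g y j l) x + partial j (fun y => g y i l) x
     - partial l (fun y => g y i j) x).

(* The l-th component of R(d_i, d_j) d_k, where
   R(X, Y) Z = nabla_X nabla_Y Z - nabla_Y nabla_X Z - nabla_[X, Y] Z. *)
Definition riemann g (l i j k : 'I_n) x : R :=
  partial i (christoffel g l j k) x - partial j (christoffel g l i k) x
  + \sum_p (christoffel g l i p x * christoffel g p j k x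
            - christoffel g l j p x * christoffel g p i k x).

(* Ric(Y, Z) is the trace of X |-> R(X, Y) Z. *)
Definition ricci g x : 'M[R]_n :=
  \matrix_(j, k) \sum_i riemann g i i j k x.

Definition gradient g (u : 'rV[R]_n -> R) x : 'rV[R]_n :=
  \row_i \sum_j invmx (g x) i j * partial j u x.

(* The trace of Y |-> nabla_Y X. *)
Definition divergence g (X : 'rV[R]_n -> 'rV[R]_n) x : R :=
  \sum_i (partial i (fun y => X y 0 i) x
          + \sum_j christoffel g i i j x * X x 0 j).

End LocalGeometry.

(* Matrices of a Riemannian metric in the charts. *)
Record metric (R : realType) n (M : manifold R n) := Metric {
  metric_mx :> chart_index M -> 'rV[R]_n -> 'M[R]_n;
  metric_smooth : forall i, smooth_on (chart_img i) (metric_mx i);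
  metric_sym : forall i x, chart_img i x -> (metric_mx i x)^T = metric_mx i x;
  metric_pos : forall i x, chart_img i x ->
    forall v, v != 0 -> 0 < inner (metric_mx i x) v v;
  metric_transition : forall i j x, chart_img i x -> chart_dom j (param i x) ->
    let tau := chart j \o param i in
    metric_mx i x =
      jacobian tau x *m metric_mx j (tau x) *m (jacobian tau x)^T
}.

Section RiemannianManifold.
Context {R : realType} {n : nat} {M : manifold R n} (g : metric M).

Definition laplacian (u : M -> R) (p : M) : R :=
  let i := chart_at p in
  divergence (g i) (gradient (g i) (u \o param i)) (chart i p).

Definition superharmonic (u : M -> R) := forall p, laplacian u p <= 0.

Definition parabolic :=
  forall u : M -> R, smooth_fun u -> (forall p, 0 < u p) -> superharmonic u ->
  exists c, forall p, u p = c.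

Definition geodesic (c : R -> M) :=
  smooth_into setT c /\
  forall t (i : chart_index M), chart_dom i (c t) ->
  let x := chart i \o c in
  forall k,
    derive1n 2 (fun s => x s 0 k) t
    + \sum_i1 \sum_i2 christoffel (g i) k i1 i2 (x t)
        * derive1 x t 0 i1 * derive1 x t 0 i2 = 0.

(* Geodesic completeness. *)
Definition complete_metric :=
  forall (p : M) (v : 'rV[R]_n), exists c : R -> M,
  [/\ geodesic c, c 0 = p & derive1 (chart (chart_at p) \o c) 0 = v].

End RiemannianManifold.

(* The Lebesgue integral over R^n of a nonnegative Borel function, as an
   iterated integral (Tonelli). *)
Fixpoint integral_rV (R : realType) (n : nat) :
    ('rV[R]_n -> \bar R) -> \bar R :=
  match n with
  | 0 => fun f => f 0
  | n'.+1 => fun f =>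
      (\int[lebesgue_measure]_(t in [set: R])
         integral_rV (fun y : 'rV[R]_n' =>
           f (row_mx (t%:M : 'rV[R]_1) y : 'rV[R]_n'.+1)))%E
  end.

Section Integration.
Context {R : realType} {n : nat} {M : manifold R n}.

(* The integral over a Borel set [B] of a nonnegative density, i.e. of a family
   of functions in the charts that transforms by the absolute value of the
   jacobian determinant: the supremum, over finite families of disjoint Borel
   pieces of [B] each contained in the domain of a chart, of the sum of the
   integrals over the pieces, computed in these charts. *)
Definition density_integral (B : set M) (w : chart_index M -> 'rV[R]_n -> R) :
    \bar R :=
  ereal_sup [set s : \bar R |
    exists m (i : 'I_m -> chart_index M) (P : 'I_m -> set M),
    [/\ forall k, <<s @open M >> (P k),
        trivIset [set: 'I_m] P,
        forall k, P k `<=` B `&` chart_dom (i k) &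
        s = (\sum_(k < m) integral_rV (fun x =>
               (w (i k) x * \1_(chart_img (i k) `&` param (i k) @^-1` P k) x)%:E))%E]].

Definition volume (B : set M) (G : chart_index M -> 'rV[R]_n -> 'M[R]_n) : \bar R :=
  density_integral B (fun i x => Num.sqrt (\det (G i x))).

(* Membership in L^1(M, g), for continuous [u]. *)
Definition L1 (g : metric M) (u : M -> R) : Prop :=
  (density_integral setT
     (fun i x => (`|u (param i x)| * Num.sqrt (\det (g i x)))%R) < +oo)%E.

End Integration.

Section Hypersurface.
Context {R : realType} {n m : nat} {M : manifold R n} {N : manifold R m}.
Variable gN : metric N.

(* The matrices, in the charts of [M], of the pullback of [gN] by [f]. *)
Definition pullback (f : M -> N) (i : chart_index M) (x : 'rV[R]_n) : 'M[R]_n :=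
  let a := chart_at (f (param i x)) in
  let h := local_map f i a in
  jacobian h x *m gN a (h x) *m (jacobian h x)^T.

(* As [g] is positive definite, [f] is automatically an immersion. *)
Definition isometric_immersion (g : metric M) (f : M -> N) : Prop :=
  smooth_map f /\ forall i x, chart_img i x -> g i x = pullback f i x.

(* The components, in the charts of [N], of a section of the pullback of the
   tangent bundle of [N] by [f]. *)
Record field_along (f : M -> N) := FieldAlong {
  field_mx :> chart_index N -> M -> 'rV[R]_m;
  field_smooth : forall (i : chart_index M) (a : chart_index N),
    smooth_on (chart_img i `&` (f \o param i) @^-1` chart_dom a)
      (field_mx a \o param i);
  field_transition : forall (a b : chart_index N) p,
    chart_dom a (f p) -> chart_dom b (f p) ->
    field_mx b p =
      field_mx a p *m jacobian (chart b \o param a) (chart a (f p))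
}.

Definition unit_normal (f : M -> N) (nu : field_along f) : Prop :=
  forall (i : chart_index M) (a : chart_index N) p,
  chart_dom i p -> chart_dom a (f p) ->
  let G := gN a (chart a (f p)) in
  inner G (nu a p) (nu a p) = 1 /\
  forall v : 'rV[R]_n,
    inner G (v *m jacobian (local_map f i a) (chart i p)) (nu a p) = 0.

Section SecondFundamentalForm.
Variables (g : metric M) (f : M -> N) (nu : field_along f).

(* Components of the covariant derivative, along d_k, of the field df(d_l),
   for the Levi-Civita connection of [gN]. *)
Definition covariant_derivative (i : chart_index M) (a : chart_index N) (k l : 'I_n)
    (x : 'rV[R]_n) : 'rV[R]_m :=
  let h := local_map f i a in
  \row_c (partial k (partial l (fun y => h y 0 c)) x
          + \sum_d \sum_e christoffel (gN a) c d e (h x)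
              * jacobian h x k d * jacobian h x l e).

(* The second fundamental form: the [nu]-component of the covariant derivative
   above, in the chart selected at [p]. *)
Definition second_fundamental_form (p : M) : 'M[R]_n :=
  let i := chart_at p in
  let a := chart_at (f p) in
  \matrix_(k, l)
    inner (gN a (chart a (f p)))
      (covariant_derivative i a k l (chart i p)) (nu a p).

(* g(A X, Y) = II(X, Y), with A acting on row vectors from the right. *)
Definition shape_operator (p : M) : 'M[R]_n :=
  let i := chart_at p in
  second_fundamental_form p *m invmx (g i (chart i p)).

(* ||A||^2 = g^{ik} g_{jl} A_i^j A_k^l *)
Definition shape_norm2 (p : M) : R :=
  let i := chart_at p in
  let G := g i (chart i p) in
  let A := shape_operator p in
  \sum_i0 \sum_j \sum_k \sum_l invmx G i0 k * G j l * A i0 j * A k l.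

Definition mean_curvature (p : M) : R := n%:R^-1 * \tr (shape_operator p).

Definition minimal : Prop := forall p, mean_curvature p = 0.

Definition totally_geodesic : Prop := forall p, second_fundamental_form p = 0.

Definition ricci_normal (p : M) : R :=
  let a := chart_at (f p) in
  inner (ricci (gN a) (chart a (f p))) (nu a p) (nu a p).

Definition jacobi_operator (u : M -> R) (p : M) : R :=
  laplacian g u p + (shape_norm2 p + ricci_normal p) * u p.

End SecondFundamentalForm.

(* A deformation of [f], defined for |t| < e, which is constant in [t] outside
   the compact set [K]. *)
Definition deformation (f : M -> N) (e : R) (K : set M) (F : R -> M -> N) :=
  [/\ 0 < e,
      forall i : chart_index M,
        smooth_into [set tx : R^o * 'rV[R]_n | `|tx.1| < e /\ chart_img i tx.2]
          (fun tx => F tx.1 (param i tx.2)),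
      F 0 = f,
      compact K &
      forall t p, `|t| < e -> ~ K p -> F t p = f p].

(* Nonnegativity of the second variation of volume; only the volume of the
   compact set [K], which is finite, varies. *)
Definition stable (f : M -> N) : Prop :=
  forall e K F, deformation f e K F ->
  0 <= derive1n 2 (fun t => fine (volume K (pullback (F t)))) 0.

End Hypersurface.

(* Main.v *)
Require Import Defs.
From mathcomp Require Import all_boot all_order all_algebra.
From mathcomp Require Import all_classical all_reals all_analysis.
Import Order.TTheory GRing.Theory Num.Theory numFieldNormedType.Exports.
Local Open Scope classical_set_scope.
Local Open Scope ring_scope.

(** As [|A|^2] and [Ric(nu, nu)] are nonnegative, the Jacobi inequality
    [Delta u + (|A|^2 + Ric(nu, nu)) u <= 0] makes the positive function [u]
    superharmonic, so that [u] is constant because [M] is parabolic. Then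
    [Delta u = 0] ([laplacian_cst]), and dividing the inequality by [u] leaves
    [|A|^2 + Ric(nu, nu) <= 0]: both terms vanish, and [|A|^2 = 0] forces the
    second fundamental form to vanish.

    The only computation is that [|A|^2] is a norm, that is, nonnegative and
    zero only for [A = 0]. In coordinates [|A|^2 = tr (G^-1 A G A^T)], where [G]
    is the matrix of the metric. A Cholesky factorization [G = B B^T]
    ([cholesky]), which expresses the metric in an orthonormal frame, turns this
    into the sum of the squares of the entries of [B^-1 A B]
    ([metric_norm2_cholesky]). *)

Section PositiveDefinite.
Context {R : rcfType}.

Definition posdef {n} (G : 'M[R]_n) : Prop :=
  forall v : 'rV[R]_n, v != 0 -> 0 < (v *m G *m v^T) 0 0.

(** Induction on the size. The corner [a] is the value of the form at the first
    basis vector, hence positive, and eliminating the first coordinate leaves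
    the Schur complement [S = D - a^-1 b^T b], which is the restriction of the form
    to the orthogonal complement of that vector, read in the remaining
    coordinates; hence [S] is again positive definite. *)
Lemma cholesky n (G : 'M[R]_n) :
  G^T = G -> posdef G -> exists B : 'M[R]_n, G = B *m B^T.
Proof.
elim: n G => [|n IH] G symG posG.
  by exists 0; rewrite (flatmx0 G) (flatmx0 (_ *m _)).
move: G symG posG; rewrite -[n.+1]/(1 + n)%N => G symG posG.
pose a := G 0 0; pose b : 'rV_n := ursubmx G; pose D := drsubmx G.
have trb : dlsubmx G = b^T by rewrite /b trmx_ursub symG.
have blockG : G = block_mx a%:M b b^T D.
  rewrite -trb -{1}[G]submxK; congr block_mx.
  by rewrite [LHS]mx11_scalar !mxE !lshift0.
have trD : D^T = D by rewrite /D trmx_drsub symG.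
have a_gt0 : 0 < a.
  have := posG (row_mx 1%:M 0); rewrite blockG tr_row_mx trmx0 mul_row_block.
  rewrite !mul0mx !addr0 mul_row_col mulmx0 addr0 trmx1 mulmx1 mul1mx.
  rewrite mxE eqxx mulr1n; apply.
  apply/eqP => /(congr1 lsubmx); rewrite row_mxKl linear0 => /matrixP/(_ 0 0).
  by rewrite !mxE eqxx => /eqP; rewrite oner_eq0.
have a_neq0 : a != 0 by rewrite gt_eqF.
pose S := D - a^-1 *: (b^T *m b).
have symS : S^T = S by rewrite /S linearB /= linearZ /= trmx_mul trmxK trD.
have posS : posdef S.
  move=> w w_neq0.
  (* The lift of [w] that is orthogonal to the first basis vector. *)
  pose v : 'rV[R]_(1 + n) := row_mx (- a^-1 *: (w *m b^T)) w.
  have vG : v *m G = row_mx 0 (w *m S).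
    rewrite blockG mul_row_block; congr row_mx.
      by rewrite mul_mx_scalar scalerA mulrN mulfV // scaleN1r addNr.
    by rewrite mulmxBr -!scalemxAl -scalemxAr mulmxA addrC scaleNr.
  have := posG v; rewrite vG tr_row_mx mul_row_col mul0mx add0r; apply.
  by apply: contra_neq w_neq0 => /(congr1 rsubmx); rewrite row_mxKr linear0.
have [C SE] := IH S symS posS.
pose r := Num.sqrt a.
have r_neq0 : r != 0 by rewrite gt_eqF // sqrtr_gt0.
have rr : r * r = a by rewrite -expr2 sqr_sqrtr // ltW.
exists (block_mx r%:M 0 (r^-1 *: b^T) C).
rewrite tr_block_mx mulmx_block blockG !trmx0 !mulmx0 !mul0mx !addr0.
rewrite tr_scalar_mx linearZ /= trmxK; congr block_mx.
- by rewrite -scalar_mxM rr.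
- by rewrite mul_scalar_mx scalerA mulfV // scale1r.
- by rewrite mul_mx_scalar scalerA mulfV // scale1r.
- rewrite -SE -scalemxAl -scalemxAr scalerA -invfM rr addrC /S.
  by rewrite subrK.
Qed.

Lemma posdef_unitmx n (G : 'M[R]_n) : posdef G -> G \in unitmx.
Proof.
move=> posG; rewrite -row_free_unit -kermx_eq0; apply/negPn/negP.
move=> /rowV0Pn[v /sub_kermxP vG0 /posG].
by rewrite vG0 mul0mx mxE ltxx.
Qed.

Lemma mxtrace_mul_tr n (C : 'M[R]_n) :
  \tr (C *m C^T) = \sum_i \sum_j C i j ^+ 2.
Proof.
by apply: eq_bigr => i _; rewrite mxE; apply: eq_bigr => j _; rewrite mxE expr2.
Qed.

Lemma mxtrace_mul_tr_ge0 n (C : 'M[R]_n) : 0 <= \tr (C *m C^T).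
Proof.
by rewrite mxtrace_mul_tr; do 2! apply: sumr_ge0 => ? _; exact: sqr_ge0.
Qed.

Lemma mxtrace_mul_tr_eq0 n (C : 'M[R]_n) : \tr (C *m C^T) = 0 -> C = 0.
Proof.
have sq_ge0 i j : true -> 0 <= C i j ^+ 2 by rewrite sqr_ge0.
rewrite mxtrace_mul_tr => C0; apply/matrixP => i j; rewrite mxE; apply/eqP.
rewrite -sqrf_eq0; apply/eqP/(psumr_eq0P (sq_ge0 i)) => //.
by apply: (psumr_eq0P _ C0) => // k _; apply: sumr_ge0 => l _; exact: sq_ge0.
Qed.

(** [g^{ik} g_{jl} A_i^j A_k^l]: the squared norm that the inner product [G]
    induces on the endomorphisms [A] of row vectors. *)
Definition metric_norm2 {n} (G A : 'M[R]_n) : R :=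
  \sum_i \sum_j \sum_k \sum_l invmx G i k * G j l * A i j * A k l.

(** As [B^-1 (B B^T) B^-T = 1], the rows of [B^-1] form an orthonormal basis,
    and [B^-1 A B] is the matrix of the endomorphism in that basis. *)
Lemma metric_norm2_cholesky n (B A : 'M[R]_n) : B \in unitmx ->
  let C := invmx B *m A *m B in
  metric_norm2 (B *m B^T) A = \tr (C *m C^T).
Proof.
move=> uB C; set G := B *m B^T.
have uBt : B^T \in unitmx by rewrite unitmx_tr.
have invG : invmx G = (invmx B)^T *m invmx B.
  have uG : G \in unitmx by rewrite unitmx_mul uB.
  apply: (can_inj (mulKmx uG)); rewrite mulmxV // trmx_inv /G.
  by rewrite mulmxA mulmxK // mulmxV.
have -> : metric_norm2 G A = \tr ((invmx G)^T *m (A *m G *m A^T)).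
  rewrite /metric_norm2 mxtrace_mulC; apply: eq_bigr => i _.
  rewrite mxE exchange_big; apply: eq_bigr => k _ /=.
  rewrite [(invmx G)^T _ _]mxE mxE mulr_suml exchange_big /=.
  apply: eq_bigr => l _; rewrite [(A *m G) _ _]mxE !mulr_suml.
  apply: eq_bigr => j _; rewrite [A^T _ _]mxE.
  by rewrite [RHS]mulrC -!mulrA; congr (_ * _); rewrite mulrCA.
rewrite invG trmx_mul trmxK -!mulmxA mxtrace_mulC /C /G !trmx_mul.
by rewrite !mulmxA.
Qed.

Lemma metric_norm2_ge0 n (G A : 'M[R]_n) :
  G^T = G -> posdef G -> 0 <= metric_norm2 G A.
Proof.
move=> symG posG; have [B GE] := cholesky n G symG posG.
have := posdef_unitmx n G posG; rewrite GE unitmx_mul => /andP[uB _].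
by rewrite metric_norm2_cholesky // mxtrace_mul_tr_ge0.
Qed.

Lemma metric_norm2_eq0 n (G A : 'M[R]_n) :
  G^T = G -> posdef G -> metric_norm2 G A = 0 -> A = 0.
Proof.
move=> symG posG; have [B GE] := cholesky n G symG posG.
have := posdef_unitmx n G posG; rewrite GE unitmx_mul => /andP[uB _].
rewrite metric_norm2_cholesky // => /mxtrace_mul_tr_eq0 C0.
by rewrite -[A](mulKVmx uB) -[invmx B *m A](mulmxK uB) C0 mul0mx mulmx0.
Qed.

End PositiveDefinite.

Lemma laplacian_cst {R : realType} {n} {M : manifold R n} (g : metric M) (c : R)
  (p : M) : laplacian g (fun=> c) p = 0.
Proof.
have grad0 : gradient (g (chart_at p)) (fun=> c) = fun=> 0.
  apply/funext => x; apply/rowP => i; rewrite !mxE big1 // => j _.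
  by rewrite /partial derive_cst mulr0.
rewrite /laplacian /divergence /comp grad0 big1 // => i _.
rewrite big1 => [|j _]; last by rewrite mxE mulr0.
have -> : (fun=> (0 : 'rV[R]_n) 0 i) = (fun=> 0 : R) :> ('rV[R]_n -> R).
  by apply/funext => y; rewrite mxE.
by rewrite /partial derive_cst addr0.
Qed.

Section ShapeOperator.
Context {R : realType} {n m : nat} {M : manifold R n} {N : manifold R m}.
Variables (gN : metric N) (g : metric M) (f : M -> N) (nu : field_along f).

Let G p := g (chart_at p) (chart (chart_at p) p).

Let symG p : (G p)^T = G p.
Proof. exact: (Defs.metric_sym g (chart_in_img (dom_chart_at p))). Qed.

Let posG p : posdef (G p).
Proof. exact: (Defs.metric_pos g (chart_in_img (dom_chart_at p))). Qed.

Lemma shape_norm2_ge0 p : 0 <= shape_norm2 gN g nu p.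
Proof. exact: (metric_norm2_ge0 _ (G p)). Qed.

(** A vanishing shape operator [A = II G^-1] gives [II = A G = 0]. *)
Lemma shape_norm2_eq0 p :
  shape_norm2 gN g nu p = 0 -> second_fundamental_form gN nu p = 0.
Proof.
move=> /(metric_norm2_eq0 _ (G p) _ (symG p) (posG p)) A0.
have uG := posdef_unitmx _ _ (posG p).
by rewrite -[LHS](mulmxKV uG) -/(shape_operator gN g nu p) A0 mul0mx.
Qed.

End ShapeOperator.

Theorem theorem5 (R : realType) (n : nat) (hn : (2 <= n)%N)
  (M : manifold R n) (N : manifold R n.+1) (g : metric M) (gN : metric N)
  (f : M -> N) (hf : isometric_immersion gN g f)
  (nu : field_along f) (hnu : unit_normal gN nu)
  (hconnected : connected [set: M])
  (hcomplete : complete_metric g)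
  (hminimal : minimal gN g nu)
  (hstable : stable gN f)
  (hricci : forall p : M, 0 <= ricci_normal gN nu p)
  (u : M -> R) (hu : smooth_fun u) (hu_pos : forall p : M, 0 < u p)
  (hu_L1 : L1 g u)
  (hu_jacobi : forall p : M, jacobi_operator gN g nu u p <= 0)
  (hparabolic : parabolic g) :
  totally_geodesic gN nu.
Proof.
have superharm_u : superharmonic g u.
  move=> p; apply: le_trans (hu_jacobi p); rewrite /jacobi_operator lerDl.
  by apply: mulr_ge0 (ltW (hu_pos p)); rewrite addr_ge0 ?shape_norm2_ge0.
have [c uc] := hparabolic u hu hu_pos superharm_u.
have {}uc : u = fun=> c by apply/funext.
move=> p; apply: (@shape_norm2_eq0 _ _ _ _ _ _ g).
have := hu_jacobi p; rewrite /jacobi_operator uc laplacian_cst add0r.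
have c_gt0 : 0 < c by have := hu_pos p; rewrite uc.
rewrite pmulr_lle0 // => A2_Ric_le0; apply/le_anti; rewrite shape_norm2_ge0 andbT.
by apply: le_trans A2_Ric_le0; rewrite lerDl.
Qed.
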